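(* Let $d\ge 2$ and $r\ge 1$ be integers. Let $m\ge 1$ be an integer such that there exist positive integers $n_1,\dots,n_d$ and a nonzero polynomial $f\in\mathbb{C}[x_{i_1,\dots,i_d}\mid i_j\in[n_j]]$ of degree $m$ that vanishes on all tensors in $\mathbb{C}^{n_1}\otimes\cdots\otimes\mathbb{C}^{n_d}$ of partition rank at most $r$. Then for every field $K$, all positive integers $n_1,\dots,n_d\ge m$ and every tensor $T\in K^{n_1}\otimes\cdots\otimes K^{n_d}$: if all subtensors $T[X_1,\dots,X_d]$ with $|X_1|=\cdots=|X_d|=m$ have partition rank at most $r$, then $$\mathrm{prk}(T)\le d(m-1)+\sum_{s=1}^{\lfloor d/2\rfloor}\binom{d}{s}(m-1)^{d-s}.$$ Moreover, for $d\ge 3$ this quantity is at most $m^d$. *)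

(* Defs.v *)
From HB Require Import structures.
From mathcomp Require Import all_boot all_algebra.
From mathcomp Require Import Rstruct.
From mathcomp Require Import complex.
From mathcomp Require Import mpoly.

Set Implicit Arguments.
Unset Strict Implicit.
Unset Printing Implicit Defensive.

Import GRing.Theory.
Local Open Scope ring_scope.

Definition CC : rcfType := Rdefinitions.R.
Definition Cplx := (CC)[i].

Definition tidx (d : nat) (n : 'I_d -> nat) : finType :=
  {dffun forall j : 'I_d, 'I_(n j)}.

Definition tensor (K : Type) (d : nat) (n : 'I_d -> nat) := tidx n -> K.

Definition depends_only_on (K : Type) (d : nat) (n : 'I_d -> nat)
    (S : {set 'I_d}) (A : tidx n -> K) : Prop :=
  forall x y : tidx n, (forall j, j \in S -> x j = y j) -> A x = A y.

Definition prk_le (K : fieldType) (d : nat) (n : 'I_d -> nat)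
    (T : tensor K n) (r : nat) : Prop :=
  exists (S : 'I_r -> {set 'I_d}) (A B : 'I_r -> tidx n -> K),
    (forall k, S k != set0 /\ S k != [set: 'I_d]) /\
    (forall k, depends_only_on (S k) (A k)) /\
    (forall k, depends_only_on (~: S k) (B k)) /\
    (forall x, T x = \sum_(k < r) A k x * B k x).

Definition subtensor (K : Type) (d : nat) (n : 'I_d -> nat)
    (T : tensor K n) (X : forall j : 'I_d, {set 'I_(n j)}) :
    tensor K (fun j => #|X j|) :=
  fun x => T (finfun (fun j => enum_val (x j)) : tidx n).

(* The coordinate variables x_{i_1..i_d}: the polynomial ring
   C[x_i | i multi-index] is {mpoly Cplx[#|tidx n|]}, variable number k
   standing for the multi-index enum_val k; a tensor T is evaluated by
   substituting T(i) for x_i. *)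
Definition eval_tensor (d : nat) (n : 'I_d -> nat)
    (f : {mpoly Cplx[#|tidx n|]}) (T : tensor Cplx n) : Cplx :=
  f.@[fun k => T (enum_val k)].

Definition prk_bound (d m : nat) : nat :=
  (d * (m - 1) + \sum_(1 <= s < (d./2).+1) 'C(d, s) * (m - 1) ^ (d - s))%N.

Arguments subtensor {K d n} T X _.

(* Main.v *)
Require Import Defs.
From HB Require Import structures.
From mathcomp Require Import all_boot all_algebra.
From mathcomp Require Import Rstruct complex mpoly.
From mathcomp Require Import zify ring.
Import GRing.Theory.
Local Open Scope ring_scope.
Set Implicit Arguments.
Unset Strict Implicit.
Unset Printing Implicit Defensive.

(* Polarizing f in each of the d directions yields a nonzero form
   F = sum_E c_E prod_(e in E) x_e on m x ... x m tensors, E ranging over the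
   perfect matchings of [m]^d, that still vanishes on partition rank <= r.
   The vanishing is a linear system in c with integer coefficients, so F may be
   taken over any field K.  Over K, F vanishes on every pullback T o g of T.
   Replace F by its partial derivatives as long as they too vanish on all
   pullbacks of T: at some point F vanishes on all pullbacks, while its
   derivative along x_e0 is nonzero at some g.  Redirecting e0_j to a free index
   y_j in F(T o g) = 0 then solves for T(y): every other monomial contains a
   cell sharing between 1 and d/2 coordinates with e0, and such cells index the
   summands of a partition rank decomposition of T. *)

(** * Elementary properties of partition rank *)

Lemma prk_le_sum (K : fieldType) (d : nat) (n : 'I_d -> nat)
    (T : tensor K n) (I : finType) (R : {set I})
    (S : I -> {set 'I_d}) (A B : I -> tidx n -> K) :
  (forall k, k \in R -> S k != set0 /\ S k != [set: 'I_d]) ->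
  (forall k, k \in R -> depends_only_on (S k) (A k)) ->
  (forall k, k \in R -> depends_only_on (~: S k) (B k)) ->
  (forall x, T x = \sum_(k in R) A k x * B k x) ->
  prk_le T #|R|.
Proof.
move=> hS hA hB hT.
exists (fun k => S (enum_val k)), (fun k => A (enum_val k)),
  (fun k => B (enum_val k)).
split; first by move=> k; apply: hS; apply: enum_valP.
split; first by move=> k; apply: hA; apply: enum_valP.
split; first by move=> k; apply: hB; apply: enum_valP.
by move=> x; rewrite hT big_enum_val.
Qed.

Lemma prk_le_trans (K : fieldType) (d : nat) (n : 'I_d -> nat)
    (T : tensor K n) (r r' : nat) :
  (2 <= d)%N -> (r <= r')%N -> prk_le T r -> prk_le T r'.
Proof.
case: d n T => [|[|d]] // n T _ le_rr' [S [A [B [hS [hA [hB hT]]]]]].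
rewrite -(subnKC le_rr'); set p := (r' - r)%N.
(* Padding by zero summands; as d >= 2, a singleton is a proper nonempty set of directions. *)
exists (fun k => if split k is inl i then S i else [set ord0]),
  (fun k => if split k is inl i then A i else fun=> 0),
  (fun k => if split k is inl i then B i else fun=> 0).
split.
  move=> k; case: (split k) => // _; split.
    by apply/set0Pn; exists ord0; rewrite inE.
  apply/eqP => /setP/(_ (lift ord0 ord0)).
  by rewrite !inE eq_sym (negbTE (neq_lift _ _)).
split; first by move=> k; case: (split k).
split; first by move=> k; case: (split k).
move=> x; rewrite hT big_split_ord /= [X in _ = _ + X]big1 ?addr0 => [|i _].
  by apply: eq_bigr => i _; rewrite -[lshift _ _]/(unsplit (inl i)) unsplitK.
by rewrite -[rshift _ _]/(unsplit (inr i)) unsplitK mul0r.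
Qed.

Definition relabel (d : nat) (n n' : 'I_d -> nat)
    (h : forall j, 'I_(n' j) -> 'I_(n j)) (x : tidx n') : tidx n :=
  [ffun j => h j (x j)].

Lemma prk_le_relabel (K : fieldType) (d : nat) (n n' : 'I_d -> nat)
    (h : forall j, 'I_(n' j) -> 'I_(n j)) (T : tensor K n) (r : nat) :
  prk_le T r -> prk_le (fun x => T (relabel h x)) r.
Proof.
case=> S [A [B [hS [hA [hB hT]]]]].
exists S, (fun k x => A k (relabel h x)), (fun k x => B k (relabel h x)).
split=> //; split; last split=> [|x]; last by rewrite hT.
  by move=> k x y xy; apply: hA => j jS; rewrite !ffunE xy.
by move=> k x y xy; apply: hB => j jS; rewrite !ffunE xy.
Qed.

(** * Forms supported on perfect matchings *)

Definition cell (d m : nat) : finType := tidx (fun _ : 'I_d => m).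

(** The index sets [I j] are a parameter because differentiating along a cell removes one index in
    each direction. *)
Definition matching (d m : nat) (I : 'I_d -> {set 'I_m})
    (E : {set cell d m}) : bool :=
  [forall j, forall a, #|[set e : cell d m in E | e j == a]| == (a \in I j)].

Definition form_val (K : fieldType) (d m : nat) (c : {set cell d m} -> K)
    (T : tensor K (fun _ : 'I_d => m)) : K :=
  \sum_E c E * \prod_(e in E) T e.

Section Matching.
Variables (d m : nat) (I : 'I_d -> {set 'I_m}).
Implicit Types (E : {set cell d m}) (e : cell d m).

Lemma matching_inj E e e' j :
  matching I E -> e \in E -> e' \in E -> e j = e' j -> e = e'.
Proof.
move=> /forallP/(_ j)/forallP/(_ (e j))/eqP h eE e'E ee'.
have: (#|[set f : cell d m in E | f j == e j]| <= 1)%N by rewrite h leq_b1.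
by move=> /card_le1_eqP; apply; rewrite inE ?eE ?e'E /= ?ee'.
Qed.

Lemma matching_in E e j : matching I E -> e \in E -> e j \in I j.
Proof.
move=> /forallP/(_ j)/forallP/(_ (e j))/eqP h eE; apply: contraT => nI.
have /eqP := h; rewrite (negbTE nI) cards_eq0 => /eqP/setP/(_ e).
by rewrite !inE eE eqxx.
Qed.

Lemma matching_ex E j a :
  matching I E -> a \in I j -> exists2 e, e \in E & e j = a.
Proof.
move=> /forallP/(_ j)/forallP/(_ a)/eqP h aI.
have /card_gt0P[e] : (0 < #|[set e : cell d m in E | e j == a]|)%N.
  by rewrite h aI.
by rewrite !inE => /andP[eE /eqP ea]; exists e.
Qed.

Lemma matchingD1 E e : matching I (e |: E) -> e \notin E ->
  matching (fun j => I j :\ e j) E.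
Proof.
move=> mE eE; apply/forallP => j; apply/forallP => a.
have /forallP/(_ j)/forallP/(_ a)/eqP := mE.
rewrite !inE; have [->|ne] /= := eqVneq a (e j).
  rewrite (matching_in j mE (setU11 _ _)) => h; rewrite cards_eq0.
  apply/eqP/setP => f; rewrite !inE; apply/andP => -[fE /eqP fe].
  by move: eE; rewrite -(matching_inj mE (setU1r _ fE) (setU11 _ _) fe) fE.
move=> <-; apply/eqP; apply: eq_card => f; rewrite !inE.
by case: (eqVneq f e) => [->|//]; rewrite eq_sym (negbTE ne) andbF andbF.
Qed.

End Matching.

(* Coefficients of the partial derivative along the variable x_e. *)
Definition deriv_form (K : fieldType) (d m : nat) (c : {set cell d m} -> K)
    (e : cell d m) (E : {set cell d m}) : K :=
  if e \in E then 0 else c (e |: E).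

(** * Solving the vanishing form for an entry of T *)

Definition agree (d m : nat) (e e' : cell d m) : {set 'I_d} :=
  [set j | e' j == e j].

Definition small_agree (d m : nat) (e : cell d m) : {set cell d m} :=
  [set e' | (0 < #|agree e e'| <= d./2)%N].

Section Solve.
Variables (K : fieldType) (d m : nat) (n : 'I_d -> nat) (T : tensor K n).
Variables (I : 'I_d -> {set 'I_m}) (c : {set cell d m} -> K).
Hypothesis d_ge2 : (2 <= d)%N.
Hypothesis c_matching : forall E, c E != 0 -> matching I E.
Hypothesis c_vanish : forall g : forall j, 'I_m -> 'I_(n j),
  form_val c (fun e => T (relabel g e)) = 0.
Variables (e0 : cell d m) (E0 : {set cell d m}).
Hypotheses (e0E0 : e0 \in E0) (cE0 : c E0 != 0).
Variable g : forall j, 'I_m -> 'I_(n j).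
Hypothesis deriv_neq0 :
  form_val (deriv_form c e0) (fun e => T (relabel g e)) != 0.

Let v := form_val (deriv_form c e0) (fun e => T (relabel g e)).
Let gy (y : tidx n) : forall j, 'I_m -> 'I_(n j) :=
  fun j t => if t == e0 j then y j else g j t.
Let F y e := T (relabel (gy y) e).

(** Every coordinate of e0 is covered by a cell of E. If a cell e meeting e0 shares more than half
    of its coordinates, it still differs from e0 at some j; the cell of E through [e0 j] is then
    another one, disjoint from e, so its agreement with e0 lies in the complementary smaller
    half. *)
Lemma exists_small_agree E : c E != 0 -> e0 \notin E ->
  exists2 e, e \in E & e \in small_agree e0.
Proof.
move=> /c_matching mE e0E; have mE0 := c_matching cE0.
have ex j : exists2 e, e \in E & e j = e0 j.
  by apply: (matching_ex mE); apply: matching_in mE0 e0E0.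
have [e eE ee0] := ex (Ordinal (ltnW d_ge2)).
have [small|big] := leqP #|agree e0 e| d./2.
  exists e => //; rewrite inE small andbT; apply/card_gt0P.
  by exists (Ordinal (ltnW d_ge2)); rewrite inE ee0.
have /existsP[j ej] : [exists j, e j != e0 j].
  rewrite -negb_forall; apply: contra e0E => /forallP h.
  by rewrite -(_ : e = e0) //; apply/ffunP => j; apply/eqP/h.
have [e' e'E e'e0] := ex j.
exists e' => //; rewrite inE; apply/andP; split.
  by apply/card_gt0P; exists j; rewrite inE e'e0.
have : agree e0 e' \subset ~: agree e0 e.
  apply/subsetP => i; rewrite !inE => /eqP e'i; apply/negP => /eqP ei.
  have ee' : e = e' by apply: (matching_inj (j := i) mE) => //; rewrite ei.
  by move: ej; rewrite ee' e'e0 eqxx.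
move=> /subset_leq_card /leq_trans; apply.
have := cardsC (agree e0 e); rewrite card_ord => h.
by have := odd_double_half d; lia.
Qed.

Lemma subst_notin E e y : c E != 0 -> e0 \in E -> e \in E -> e != e0 ->
  F y e = T (relabel g e).
Proof.
move=> /c_matching mE e0E eE ne; congr T; apply/ffunP => j; rewrite !ffunE /gy.
by case: eqP => // /(matching_inj mE eE e0E) /eqP; rewrite (negbTE ne).
Qed.

Lemma subst_base y : F y e0 = T y.
Proof. by congr T; apply/ffunP => j; rewrite !ffunE /gy eqxx. Qed.

(** In a matching containing e0 the other cells share no coordinate with e0, so the redirection
    leaves their factors alone and turns the factor at e0 into [T y]. These monomials add up to the
    derivative times [T y]. *)
Lemma expansion y :
  v * T y + \sum_(E : {set cell d m} | e0 \notin E)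
              c E * \prod_(e in E) F y e = 0.
Proof.
rewrite -[RHS](c_vanish (gy y)) /form_val [RHS](bigID (fun E : {set cell d m} => e0 \in E)) /=.
congr (_ + _).
rewrite [RHS](reindex_onto (fun E : {set cell d m} => e0 |: E)
  (fun E => E :\ e0)) /=; last first.
  by move=> E e0E; rewrite setD1K.
rewrite /v /form_val (bigID (fun E : {set cell d m} => e0 \in E)) /= big1 ?add0r; last first.
  by move=> E e0E; rewrite /deriv_form e0E mul0r.
rewrite mulr_suml; apply: eq_big => [E|E e0E].
  rewrite setU11 /=; have [e0E|e0E] /= := boolP (e0 \in E).
    by apply/esym/negP => /eqP/setP/(_ e0); rewrite !inE e0E eqxx.
  by rewrite setU1K ?eqxx.
rewrite /deriv_form (negbTE e0E); have [->|nz] := eqVneq (c (e0 |: E)) 0.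
  by rewrite !mul0r.
rewrite -mulrA; congr (_ * _); rewrite big_setU1 //= -/(F y e0) subst_base mulrC.
congr (_ * _); apply: eq_bigr => e eE.
rewrite -/(F y e) (subst_notin y nz) ?setU11 ?setU1r //.
by apply: contraNneq e0E => <-.
Qed.

(** For E in the support avoiding e0 the choice succeeds, so the default [e0] is not returned
    there. *)
Let pk (E : {set cell d m}) : cell d m :=
  odflt e0 [pick e in E | e \in small_agree e0].

Lemma pkP E : c E != 0 -> e0 \notin E -> pk E \in E /\ pk E \in small_agree e0.
Proof.
move=> cE e0E; rewrite /pk; case: pickP => [e /andP[]|] //=.
by have [e eE es] := exists_small_agree cE e0E; move/(_ e); rewrite eE es.
Qed.

(** Dividing [expansion] by v and grouping the monomials by e = [pk E] gives one product for each e.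
    The factor at e sees y only on [agree e0 e]; the other cells of E share no coordinate with e, so
    their factors see y only on the complement. *)
Lemma prk_le_solve : prk_le T #|small_agree e0|.
Proof.
pose P (E : {set cell d m}) := (c E != 0) && (e0 \notin E).
apply: (prk_le_sum (S := agree e0) (A := fun e y => F y e)
  (B := fun e y => - v^-1 * \sum_(E | P E && (pk E == e))
                   c E * \prod_(e' in E :\ e) F y e')).
- move=> e; rewrite inE => /andP[pos small]; split; first by rewrite -card_gt0.
  apply: contraTneq small => ->; rewrite cardsT card_ord -ltnNge.
  by have := odd_double_half d; lia.
- move=> e _ x y xy; congr T; apply/ffunP => j; rewrite !ffunE /gy.
  by case: eqP => // ej; apply: xy; rewrite inE ej.
- move=> e _ x y xy; congr (_ * _).
  apply: eq_bigr => E /andP[/andP[cE e0E] /eqP pkE].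
  have [eE _] := pkP cE e0E; rewrite pkE in eE.
  congr (_ * _); apply: eq_bigr => e'; rewrite !inE => /andP[ne e'E].
  congr T; apply/ffunP => j; rewrite !ffunE /gy; case: eqP => // e'j.
  apply: xy; rewrite !inE; apply: contraNneq ne => ej.
  by apply/eqP; apply: (matching_inj (j := j) (c_matching cE)); rewrite ?ej.
move=> y; have := expansion y.
have -> : \sum_(E : {set cell d m} | e0 \notin E) c E * \prod_(e in E) F y e =
    \sum_(E | P E) c E * \prod_(e in E) F y e.
  rewrite (bigID (fun E : {set cell d m} => c E != 0)) /= addrC big1 ?add0r; last first.
    by move=> E /andP[_]; rewrite negbK => /eqP ->; rewrite mul0r.
  by apply: eq_bigl => E; rewrite andbC.
rewrite (partition_big pk (fun e => e \in small_agree e0)) /=; last first.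
  by move=> E /andP[cE e0E]; have [] := pkP cE e0E.
move/eqP; rewrite addrC addr_eq0 => /eqP h.
rewrite -[T y](mulKf deriv_neq0) -/v -[v * T y]opprK -h mulrN -mulNr mulr_sumr.
apply: eq_bigr => e _; rewrite mulrCA; congr (_ * _).
rewrite mulr_sumr; apply: eq_bigr => E /andP[/andP[cE e0E] /eqP pkE].
have [eE _] := pkP cE e0E; rewrite pkE in eE.
by rewrite (big_setD1 e) //= mulrCA.
Qed.

End Solve.

(** * Counting the summands *)

Lemma card_agree_eq (d m : nat) (e : cell d m) (S : {set 'I_d}) :
  #|[set e' | agree e e' == S]| = ((m - 1) ^ (d - #|S|))%N.
Proof.
pose F j : pred 'I_m := fun a => (a == e j) == (j \in S).
transitivity #|family F|.
  apply: eq_card => e'; rewrite inE; apply/eqP/familyP => [h j|h].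
    by rewrite -topredE /= /F -h inE.
  by apply/setP => j; rewrite inE; have /eqP := h j.
rewrite card_family foldrE big_map big_enum /=.
rewrite (bigID (fun j => j \in S)) /= big1 ?mul1n => [|j jS]; last first.
  by rewrite -(card1 (e j)); apply: eq_card => a; rewrite -topredE /= /F jS eqb_id.
rewrite (eq_bigr (fun=> (m - 1)%N)) => [|j jS].
  rewrite prod_nat_const; congr (_ ^ _)%N.
  have := cardsCs (~: S); rewrite setCK card_ord => <-.
  by apply: eq_card => j; rewrite inE.
have /(congr1 (subn^~ 1%N)) := cardC (pred1 (e j)).
rewrite card1 card_ord addKn => <-.
by apply: eq_card => a; rewrite -[LHS]topredE /= /F (negbTE jS) eqbF_neg.
Qed.

Lemma card_small_agree (d m : nat) (e : cell d m) :
  #|small_agree e| =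
  (\sum_(1 <= s < (d./2).+1) 'C(d, s) * (m - 1) ^ (d - s))%N.
Proof.
rewrite -sum1_card.
rewrite (partition_big (agree e) (fun S : {set 'I_d} => 0 < #|S| <= d./2)%N);
  last by move=> e'; rewrite inE.
have aux (S : {set 'I_d}) : (0 < #|S| <= d./2)%N ->
    (\sum_(e' in small_agree e | agree e e' == S) 1 = (m - 1) ^ (d - #|S|))%N.
  move=> hS; rewrite -(card_agree_eq e S) -sum1_card; apply: eq_bigl => e'.
  by rewrite !inE; case: eqP => [->|_]; rewrite ?hS ?andbF.
rewrite (eq_bigr _ aux) {aux}.
(* A dummy index s equal to [#|S|] is inserted so that the two sums can be exchanged. *)
transitivity (\sum_(S : {set 'I_d} | (0 < #|S| <= d./2)%N)
   \sum_(1 <= s < (d./2).+1 | s == #|S|) (m - 1) ^ (d - s))%N.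
  apply: eq_bigr => S hS; rewrite big_nat_cond.
  rewrite (big_rem #|S|) /=; last by rewrite mem_index_iota.
  rewrite eqxx andbT ltnS hS big1_seq ?addn0 // => s /andP[/andP[_ /eqP->]].
  by rewrite mem_rem_uniq ?iota_uniq // inE eqxx.
rewrite (exchange_big_dep xpredT) //= [LHS]big_nat [RHS]big_nat.
apply: eq_bigr => s hs; have := card_draws 'I_d s; rewrite card_ord => <-.
rewrite -sum_nat_const.
apply: eq_bigl => S; rewrite !inE eq_sym; case: eqP => [->|]; rewrite ?andbF //.
by rewrite -ltnS hs.
Qed.

(** * Descent through partial derivatives *)

Lemma prk_le_of_form (K : fieldType) (d m : nat) (n : 'I_d -> nat)
    (T : tensor K n) (I : 'I_d -> {set 'I_m}) (c : {set cell d m} -> K)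
    (E0 : {set cell d m}) :
  (2 <= d)%N -> (forall E, c E != 0 -> matching I E) -> c E0 != 0 ->
  (forall g : forall j, 'I_m -> 'I_(n j),
     form_val c (fun e => T (relabel g e)) = 0) ->
  (forall j, n j > 0)%N ->
  prk_le T (\sum_(1 <= s < (d./2).+1) 'C(d, s) * (m - 1) ^ (d - s))%N.
Proof.
move=> d2 + + + n_gt0; set j0 : 'I_d := Ordinal (ltnW d2).
(* Each derivative removes an index from [I j0], so the descent stops: once [I j0] is empty, only
   the empty matching remains and the form is a nonzero constant, which cannot vanish at a
   pullback. *)
have [k] := ubnP #|I j0|; elim: k => // k IH in I c E0 *.
move=> Ik cI cE0 c0; have [I0|[a aI]] := set_0Vmem (I j0).
  have E_eq0 E : c E != 0 -> E = set0.
    move=> /cI mE; apply/eqP; rewrite -subset0; apply/subsetP => e eE.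
    by have := matching_in j0 mE eE; rewrite I0 inE.
  have /eqP := c0 (fun j _ => Ordinal (n_gt0 j)).
  rewrite /form_val (bigD1 E0) //= {2}(E_eq0 _ cE0) big_set0 mulr1.
  rewrite big1 ?addr0 ?(negbTE cE0) // => E neE.
  have [->|cE] := eqVneq (c E) 0; first by rewrite mul0r.
  by move: neE; rewrite (E_eq0 _ cE) (E_eq0 _ cE0) eqxx.
have [e0 e0E0 e0a] := matching_ex (cI _ cE0) aI.
(* Pullback maps are encoded in a finite type, so that vanishing of the derivative on all of them is
   decidable. *)
pose G := {dffun forall j : 'I_d, {ffun 'I_m -> 'I_(n j)}}.
case: (boolP [forall g : G, form_val (deriv_form c e0)
    (fun e => T (relabel (fun j => g j) e)) == 0]) => [/forallP d0|].
  apply: (IH (fun j => I j :\ e0 j) (deriv_form c e0) (E0 :\ e0)).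
  - by move: Ik; rewrite (cardsD1 (e0 j0)) {1}e0a aI add1n ltnS.
  - move=> E; rewrite /deriv_form; case: ifPn; first by rewrite eqxx.
    by move=> e0E /cI mE; apply: matchingD1.
  - by rewrite /deriv_form setD11 setD1K.
  move=> g; have /eqP := d0 [ffun j => [ffun a => g j a]].
  move=> <-; apply: eq_bigr => E _; congr (_ * _); apply: eq_bigr => e _.
  by congr T; apply/ffunP => j; rewrite !ffunE.
rewrite negb_forall => /existsP[g nz]; rewrite -(card_small_agree e0).
exact: (prk_le_solve d2 cI c0 e0E0 cE0 nz).
Qed.

(** Expand [((m - 1) + 1) ^ d]: the terms of index 1 to d/2 give the sum, and the linear term is the
    one of index d - 1, which exceeds d/2 because d >= 3. *)
Lemma prk_bound_le_expn (d m : nat) : (1 <= m)%N -> (3 <= d)%N ->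
  (prk_bound d m <= m ^ d)%N.
Proof.
move=> m1 d3; rewrite /prk_bound -[X in (_ <= X ^ _)%N](subnK m1) expnDn.
set h := d./2; have := odd_double_half d; rewrite -/h => hd.
rewrite -(big_mkord xpredT (fun i => 'C(d, i) * ((m - 1) ^ (d - i) * 1 ^ i))%N).
have le_h : (h.+1 <= d.+1)%N by lia.
rewrite [X in (_ <= X)%N](big_cat_nat (n := h.+1)) //=.
rewrite [X in (X <= _)%N]addnC; apply: leq_add.
  rewrite [X in (_ <= X)%N]big_ltn //; apply: leq_trans (leq_addl _ _).
  by apply: leq_sum => i _; rewrite exp1n muln1.
rewrite (bigD1_seq d.-1) ?iota_uniq //=; last by rewrite mem_index_iota; lia.
apply: leq_trans (leq_addr _ _).
have -> : 'C(d, d.-1) = d by rewrite -subn1 bin_sub ?bin1 //; lia.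
have -> : (d - d.-1 = 1)%N by lia.
by rewrite expn1 exp1n muln1.
Qed.

(** * Transfer of the form to an arbitrary field *)

(* A full-rank system over K has a maximal minor that is nonzero in K, hence
   nonzero as an integer, hence nonzero in F. *)
Lemma int_kernel_transfer (I J : finType) (A : I -> J -> int) (F K : fieldType)
    (v : J -> F) (j0 : J) :
  (forall z : int, z%:~R = 0 :> F -> z = 0) -> v j0 != 0 ->
  (forall i, \sum_j (A i j)%:~R * v j = 0) ->
  exists w : J -> K, (exists j, w j != 0) /\
    (forall i, \sum_j (A i j)%:~R * w j = 0).
Proof.
move=> F0 vj0 Av; pose M := \matrix_(i < #|I|, j < #|J|)
  A (enum_val i) (enum_val j).
have [full|nfull] := boolP (row_full (map_mx (intr : int -> K) M)).
  have := fullrowsub_unit full; set f := fullrankfun full.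
  rewrite -map_mxsub unitmxE det_map_mx unitfE => detK.
  have detF : map_mx (intr : int -> F) (rowsub f M) \in unitmx.
    rewrite unitmxE det_map_mx unitfE; apply: contraNneq detK => /F0 ->.
    by rewrite rmorph0.
  pose u : 'cV[F]_#|J| := \col_j v (enum_val j).
  have Mu : map_mx (intr : int -> F) (rowsub f M) *m u = 0.
    apply/colP => i; rewrite !mxE -[RHS](Av (enum_val (f i))).
    rewrite [RHS]big_enum_val /=.
    by apply: eq_bigr => j _; rewrite !mxE.
  have /colP/(_ (enum_rank j0)) : u = 0 by rewrite -(mulKmx detF u) Mu mulmx0.
  by rewrite !mxE enum_rankK => vj; rewrite vj eqxx in vj0.
(* [kermx] is a left kernel, hence the transpose. *)
pose MK := (map_mx (intr : int -> K) M)^T.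
have nz : nz_row (kermx MK) != 0.
  by rewrite nz_row_eq0 kermx_eq0 /row_free mxrank_tr.
have := nz_row_sub (kermx MK); set u := nz_row _ in nz * => /sub_kermxP uMK.
exists (fun j => u 0 (enum_rank j)); split.
  by have /rV0Pn[j uj] := nz; exists (enum_val j); rewrite enum_valK.
move=> i; have /rowP/(_ (enum_rank i)) := uMK; rewrite !mxE => {2}<-.
rewrite big_enum_val /=; apply: eq_bigr => j _.
by rewrite !mxE enum_rankK enum_valK mulrC.
Qed.

Definition update (V : finType) (K : Type) (a : {ffun V -> K}) (v : V) (t : K) :
    {ffun V -> K} :=
  [ffun x => if x == v then t else a x].

(** Induction on the number of coordinates outside {0, 1}: each such value is interpolated from 0
    and 1. No division occurs, so finite fields are covered. *)
Lemma multiaffine_eq0 (V : finType) (K : fieldType) (P : {ffun V -> K} -> K) :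
  (forall a v t, P (update a v t) =
     (1 - t) * P (update a v 0) + t * P (update a v 1)) ->
  (forall b : {ffun V -> bool}, P [ffun x => (b x)%:R] = 0) ->
  forall a, P a = 0.
Proof.
move=> affP cubeP a; pose bad (a : {ffun V -> K}) :=
  [set x | (a x != 0) && (a x != 1)].
have [k] := ubnP #|bad a|; elim: k => // k IH in a *; rewrite ltnS => bk.
have [b0|[v vb]] := set_0Vmem (bad a).
  rewrite -(cubeP [ffun x => a x == 1]); congr P; apply/ffunP => x.
  have /setP/(_ x) := b0; rewrite !inE !ffunE.
  by case: (eqVneq (a x) 1) => [->|_] //; rewrite andbT => /negbFE/eqP ->.
have upd (t : bool) : P (update a v t%:R) = 0.
  apply: IH; apply: leq_trans bk; apply: proper_card; apply/properP; split.
    apply/subsetP => x; rewrite !inE !ffunE; case: (x == v) => //.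
    by case: t; rewrite /= ?mulr1n ?mulr0n eqxx ?andbF.
  by exists v => //; rewrite !inE !ffunE eqxx; case: t; rewrite /= ?mulr1n ?mulr0n eqxx ?andbF.
have -> : a = update a v (a v) by apply/ffunP => x; rewrite ffunE; case: eqP => [->|].
by rewrite affP (upd false) (upd true) !mulr0 addr0.
Qed.

(** Marking the coordinates outside X by [None] puts the partial indices for all X into one finite
    type. *)
Definition restr (d m : nat) (X : {set 'I_d}) (e : cell d m) :
    {ffun 'I_d -> option 'I_m} :=
  [ffun j => if j \in X then Some (e j) else None].

(* Coordinates (b, k, u) of the parametrization of tensors of partition rank
   <= r: the value of A k (b = true) or B k (b = false) at the partial index u. *)
Definition param (d m r : nat) : finType :=
  (bool * 'I_r * {ffun 'I_d -> option 'I_m})%type.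

Section Parametrization.
Variables (K : fieldType) (d m r : nat) (S : {ffun 'I_r -> {set 'I_d}}).
Hypothesis S_proper : forall k, S k != set0 /\ S k != [set: 'I_d].

Definition param_tensor (a : {ffun param d m r -> K}) :
    tensor K (fun _ : 'I_d => m) :=
  fun e => \sum_(k < r)
    a (true, k, restr (S k) e) * a (false, k, restr (~: S k) e).

Lemma restr_depends (R : Type) X (h : {ffun 'I_d -> option 'I_m} -> R) :
  depends_only_on (n := fun=> m) X (fun e => h (restr X e)).
Proof.
move=> x y xy; congr h; apply/ffunP => j; rewrite !ffunE.
by case: ifP => // /xy ->.
Qed.

Lemma restr_eq X (e e' : cell d m) j :
  restr X e = restr X e' -> j \in X -> e j = e' j.
Proof. by move=> /ffunP/(_ j); rewrite !ffunE => + jX; rewrite jX => -[]. Qed.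

Lemma prk_le_param_tensor a : prk_le (param_tensor a) r.
Proof.
exists S, (fun k e => a (true, k, restr (S k) e)),
  (fun k e => a (false, k, restr (~: S k) e)).
by split=> //; split=> [k|]; last split=> // k;
  [exact: (@restr_depends K (S k) (fun u => a (true, k, u)))
  |exact: (@restr_depends K (~: S k) (fun u => a (false, k, u)))].
Qed.

Lemma param_tensor_surj (T : tensor K (fun _ : 'I_d => m))
    (A B : 'I_r -> cell d m -> K) :
  (forall k, depends_only_on (S k) (A k)) ->
  (forall k, depends_only_on (~: S k) (B k)) ->
  (forall x, T x = \sum_(k < r) A k x * B k x) ->
  exists a, T =1 param_tensor a.
Proof.
move=> hA hB hT.
(* A parameter is read off at any cell with the given restriction, which is unambiguous by the
   dependence of [A k] and [B k]; partial indices that restrict no cell get 0. *)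
pose f (p : param d m r) : K := let: (b, k, u) := p in
  if [pick e : cell d m | restr (if b then S k else ~: S k) e == u] is Some e
  then if b then A k e else B k e else 0.
exists (finfun f).
move=> e; rewrite hT; apply: eq_bigr => k _; rewrite !ffunE /f.
congr (_ * _); case: pickP => [e' /eqP re|/(_ e)]; rewrite ?eqxx //.
  by apply: hA => j jS; rewrite (restr_eq re).
by apply: hB => j jS; rewrite (restr_eq re).
Qed.

Lemma param_tensor_affine a v t e :
  param_tensor (update a v t) e =
  (1 - t) * param_tensor (update a v 0) e + t * param_tensor (update a v 1) e.
Proof.
rewrite /param_tensor !mulr_sumr -big_split; apply: eq_bigr => k _ /=.
rewrite !ffunE; case: eqVneq => [<-|_] /=; last by case: eqP => _; ring.
by ring.
Qed.

Lemma param_tensor_update a b k u s t e :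
  restr (if b then S k else ~: S k) e != u ->
  param_tensor (update a (b, k, u) t) e =
  param_tensor (update a (b, k, u) s) e.
Proof.
move=> ne; apply: eq_bigr => i _; rewrite !ffunE !xpair_eqE.
by case: b ne => ne /=; case: (eqVneq i k) => [->|_] //=; rewrite (negbTE ne).
Qed.

(** The side X of a proper splitting is nonempty, so two cells with the same restriction to X share
    a coordinate and coincide within a matching. Hence a parameter enters at most one factor of a
    monomial, and that factor is affine in it. *)
Lemma form_val_param_affine I (c : {set cell d m} -> K) a v t :
  (forall E, c E != 0 -> matching I E) ->
  form_val c (param_tensor (update a v t)) =
  (1 - t) * form_val c (param_tensor (update a v 0)) +
  t * form_val c (param_tensor (update a v 1)).
Proof.
move=> cI; rewrite /form_val !mulr_sumr -big_split; apply: eq_bigr => E _ /=.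
have [->|/cI mE] := eqVneq (c E) 0; first by rewrite !mul0r !mulr0 addr0.
case: v => -[b k] u; pose X := if b then S k else ~: S k.
have [j jX] : exists j, j \in X.
  have [S0 ST] := S_proper k; apply/set0Pn; rewrite /X; case: (b) => //.
  by apply: contraNneq ST => SC; rewrite -(setCK (S k)) SC setC0.
rewrite ![_ * (c E * _)]mulrCA -mulrDr; congr (_ * _).
have [/existsP[e /andP[eE /eqP eu]]|none] :=
  boolP [exists e in E, restr X e == u]; last first.
  have eq0 s : \prod_(e in E) param_tensor (update a (b, k, u) s) e =
      \prod_(e in E) param_tensor (update a (b, k, u) 0) e.
    apply: eq_bigr => e eE; apply: param_tensor_update.
    by apply: contraNneq none => eu; apply/existsP; exists e; rewrite eE eu eqxx.
  by rewrite (eq0 t) (eq0 1); ring.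
have eq0 s : \prod_(e' in E) param_tensor (update a (b, k, u) s) e' =
    param_tensor (update a (b, k, u) s) e *
    \prod_(e' in E | e' != e) param_tensor (update a (b, k, u) 0) e'.
  rewrite (bigD1 e) //=; congr (_ * _); apply: eq_bigr => e' /andP[e'E ne].
  apply: param_tensor_update; apply: contraNneq ne => e'u; apply/eqP.
  by apply: (matching_inj mE e'E eE (restr_eq (etrans e'u (esym eu)) jX)).
by rewrite (eq0 t) (eq0 0) (eq0 1) param_tensor_affine; ring.
Qed.

End Parametrization.

(* In a matching no parameter occurs twice, so monomials are multi-affine in the
   parameters and vanishing at 0/1 parameters suffices. *)
Lemma form_transfer (d m r : nat) (F K : fieldType) (I : 'I_d -> {set 'I_m})
    (c : {set cell d m} -> F) (E0 : {set cell d m}) :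
  (forall z : int, z%:~R = 0 :> F -> z = 0) ->
  (forall E, c E != 0 -> matching I E) -> c E0 != 0 ->
  (forall T, prk_le T r -> form_val c T = 0) ->
  exists c' : {set cell d m} -> K, (exists E, c' E != 0) /\
    (forall E, c' E != 0 -> matching I E) /\
    (forall T, prk_le T r -> form_val c' T = 0).
Proof.
move=> F0 cI cE0 c0.
pose V := param d m r.
pose proper (S : {ffun 'I_r -> {set 'I_d}}) :=
  [forall k, (S k != set0) && (S k != [set: 'I_d])].
pose mono (S : {ffun 'I_r -> {set 'I_d}}) (b : {ffun V -> bool})
    (E : {set cell d m}) : int :=
  \prod_(e in E) \sum_(k < r)
    (b (true, k, restr (S k) e))%:R * (b (false, k, restr (~: S k) e))%:R.
(* The unknowns are the coefficients of the form. Row [inl (X, b)] expresses vanishing at the 0/1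
   parameters b of shape X; row [inr E1] kills the coefficient of E1 unless E1 is a matching. The
   integer entries serve both fields. *)
pose A (i : ({ffun 'I_r -> {set 'I_d}} * {ffun V -> bool}) + {set cell d m})
    (E : {set cell d m}) : int :=
  match i with
  | inl (X, b) => if proper X then mono X b E else 0
  | inr E1 => ((E == E1) && ~~ matching I E)%:R
  end.
have monoE (L : fieldType) S b E : (mono S b E)%:~R =
    \prod_(e in E) param_tensor S [ffun x => (b x)%:R : L] e.
  rewrite rmorph_prod; apply: eq_bigr => e _; rewrite rmorph_sum.
  by apply: eq_bigr => k _; rewrite rmorphM !ffunE /= !rmorph_nat.
have [|w [[E wE] Aw]] := @int_kernel_transfer _ _ A F K c E0 F0 cE0.
  move=> [[S b]|E1] /=.
    case: (boolP (proper S)) => [/forallP pS|_]; last by rewrite big1 // => E _; rewrite mul0r.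
    apply: etrans (c0 _ (prk_le_param_tensor (fun k => andP (pS k))
      [ffun x => (b x)%:R : F])).
    by apply: eq_bigr => E _; rewrite monoE mulrC.
  rewrite big1 // => E _; case: (boolP (matching I E)) => [_|nE].
    by rewrite andbF mul0r.
  by have [->|/cI mE] := eqVneq (c E) 0; [rewrite mulr0|rewrite mE in nE].
have wI E1 : w E1 != 0 -> matching I E1.
  apply: contraR => nE; rewrite -(Aw (inr E1)) (bigD1 E1) //= eqxx nE mul1r.
  by rewrite big1 ?addr0 // => E2 /negbTE ->; rewrite mul0r.
exists w; split; first by exists E.
split=> // T [S [B [C [pS [hB [hC hT]]]]]].
have pS' : forall k, [ffun k => S k] k != set0 /\ [ffun k => S k] k != [set: 'I_d].
  by move=> k; rewrite ffunE.
have [|||a Ta] := @param_tensor_surj K d m r [ffun k => S k] T B C.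
- by move=> k; rewrite ffunE.
- by move=> k; rewrite ffunE.
- exact: hT.
transitivity (form_val w (param_tensor [ffun k => S k] a)).
  by apply: eq_bigr => E1 _; congr (_ * _); apply: eq_bigr => e _.
move: a {Ta}; apply: multiaffine_eq0 => [a v t|b].
  exact: (form_val_param_affine pS' _ _ _ wI).
have pST : proper [ffun k => S k] by apply/forallP => k; apply/andP.
apply: etrans (Aw (inl ([ffun k => S k], b))); rewrite /A pST.
by apply: eq_bigr => E1 _; rewrite monoE mulrC.
Qed.

(** * Multilinear images and polarization *)

Lemma prk_le_linear_image (K : fieldType) (d m r : nat) (n : 'I_d -> nat)
    (M : forall j, 'I_(n j) -> 'I_m -> K) (T : tensor K (fun _ : 'I_d => m)) :
  (0 < m)%N -> prk_le T r ->
  prk_le (fun x : tidx n => \sum_(y : cell d m) (\prod_j M j (x j) (y j)) * T y) r.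
Proof.
case: m M T => // m M T _ [S [A [B [hS [hA [hB hT]]]]]].
(* A partial index on X is represented by the cell that is [ord0] outside X. A cell y is then a pair
   of partial indices on [S k] and its complement, and the sum over y factors accordingly. *)
pose pr (X : {set 'I_d}) (y : cell d m.+1) : cell d m.+1 :=
  [ffun j => if j \in X then y j else ord0].
pose side X (H : cell d m.+1 -> K) (x : tidx n) :=
  \sum_(y | pr X y == y) (\prod_(j in X) M j (x j) (y j)) * H y.
have dep X H : depends_only_on X (side X H).
  move=> x x' xx'; apply: eq_bigr => y _; congr (_ * _).
  by apply: eq_bigr => j /xx' ->.
exists S, (fun k => side (S k) (A k)), (fun k => side (~: S k) (B k)).
split=> //; split; first by move=> k; apply: dep.
split=> [k|x]; first exact: dep.
under eq_bigr do rewrite hT mulr_sumr.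
rewrite exchange_big /=; apply: eq_bigr => k _.
rewrite /side big_distrlr pair_big /=.
pose split_cell y := (pr (S k) y, pr (~: S k) y).
pose merge (p : cell d m.+1 * cell d m.+1) : cell d m.+1 :=
  [ffun j => if j \in S k then p.1 j else p.2 j].
rewrite [RHS](reindex_onto split_cell merge) /=; last first.
  move=> [y z] /= /andP[/eqP yS /eqP zS]; rewrite /split_cell; congr pair.
    by rewrite -[RHS]yS; apply/ffunP => j; rewrite !ffunE; case: (j \in S k).
  by rewrite -[RHS]zS; apply/ffunP => j; rewrite !ffunE inE; case: (j \in S k).
apply: eq_big => [y|y _].
  apply/esym/andP; split; last first.
    by apply/eqP/ffunP => j; rewrite !ffunE inE; case: (j \in S k).
  by apply/andP; split; apply/eqP/ffunP => j; rewrite !ffunE; case: (j \in _).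
rewrite mulrACA (hA k (pr (S k) y) y); last by move=> j jS; rewrite ffunE jS.
rewrite (hB k (pr (~: S k) y) y); last by move=> j jS; rewrite ffunE jS.
congr (_ * _); rewrite (bigID (fun j => j \in S k)) /=; congr (_ * _).
  by apply: eq_bigr => j jS; rewrite ffunE jS.
by apply: eq_big => [j|j jS]; rewrite ?inE // ffunE inE jS.
Qed.

Lemma prod_bool (R : comNzRingType) (I : finType) (P : pred I) :
  \prod_i (P i)%:R = [forall i, P i]%:R :> R.
Proof.
case: (boolP [forall i, P i]) => [/forallP Pi|].
  by rewrite big1 // => i _; rewrite Pi.
by rewrite negb_forall => /existsP[i /negbTE Pi]; rewrite (bigD1 i) //= Pi mul0r.
Qed.

Section Polarization.
Variables (K : fieldType) (d m : nat) (n : 'I_d -> nat).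
Variables (iota : 'I_m -> tidx n) (T : tensor K (fun _ : 'I_d => m)).

(** Image of T under the linear maps sending basis vector a of direction j to basis vector
    [iota a j] if [s (j, a)] holds, and to 0 otherwise. *)
Definition polar_tensor (s : {ffun 'I_d * 'I_m -> bool}) : tensor K n :=
  fun x => \sum_(y : cell d m)
    (\prod_j ((iota (y j) j == x j)%:R * (s (j, y j))%:R)) * T y.

Definition assembles (w : seq (tidx n)) (y : {ffun 'I_(size w) -> cell d m}) :=
  [forall p : 'I_d * 'I_m, [exists s, y s p.1 == p.2]] &&
  [forall s, [forall j, iota (y s j) j == tnth (in_tuple w) s j]].

Definition alt_sign (s : {ffun 'I_d * 'I_m -> bool}) : K :=
  \prod_p (-1) ^+ (s p).

(* The alternating sum kills every y missing some index in some direction. *)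
Lemma polarization (w : seq (tidx n)) :
  \sum_s alt_sign s * \prod_(x <- w) polar_tensor s x =
  (\prod_(p : 'I_d * 'I_m) -1) * \sum_(y | @assembles w y) \prod_s T (y s).
Proof.
pose tw := tnth (in_tuple w).
have expand s : \prod_(x <- w) polar_tensor s x =
    \sum_(y : {ffun 'I_(size w) -> cell d m})
      [forall i, [forall j, iota (y i j) j == tw i j]]%:R *
      ((\prod_p ([exists i, y i p.1 == p.2] ==> s p)%:R) *
       \prod_i T (y i)).
  rewrite big_tnth bigA_distr_bigA /=; apply: eq_bigr => y _.
  rewrite big_split /= mulrA; congr (_ * _).
  under eq_bigr do rewrite big_split /=.
  rewrite big_split /=; congr (_ * _).
    by rewrite -prod_bool; apply: eq_bigr => i _; rewrite -prod_bool.
  rewrite prod_bool; under eq_bigr do rewrite prod_bool.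
  rewrite prod_bool; congr (_%:R); congr nat_of_bool.
  apply/forallP/forallP => [h [j a]|h i].
    apply/implyP => /existsP[i /eqP /= <-].
    by have /forallP := h i.
  apply/forallP => j; have /implyP := h (j, y i j); apply.
  by apply/existsP; exists i.
under eq_bigr do rewrite expand mulr_sumr.
rewrite exchange_big mulr_sumr /= [RHS]big_mkcond /=; apply: eq_bigr => y _.
transitivity ([forall i, [forall j, iota (y i j) j == tw i j]]%:R *
  (\prod_i T (y i)) * \sum_s alt_sign s *
    (\prod_p ([exists i, y i p.1 == p.2] ==> s p)%:R)).
  rewrite mulr_sumr; apply: eq_bigr => s _; ring.
(* The sum over s factors over the pairs p: a pair that is hit forces [s p] and contributes -1,
   while a missed pair contributes 1 - 1 = 0. *)
have -> : \sum_s alt_sign s *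
    (\prod_p ([exists i, y i p.1 == p.2] ==> s p)%:R) =
    (\prod_(p : 'I_d * 'I_m) -1) *
      [forall p : 'I_d * 'I_m, [exists i, y i p.1 == p.2]]%:R.
  under eq_bigr do rewrite -big_split /=.
  rewrite -(bigA_distr_bigA (fun (p : 'I_d * 'I_m) (b : bool) =>
    (-1) ^+ b * ([exists i, y i p.1 == p.2] ==> b)%:R : K)).
  rewrite -prod_bool -big_split; apply: eq_bigr => p _ /=.
  rewrite big_bool /= implybT implybF; case: [exists i, _] => /=; ring.
rewrite /assembles -/tw.
case: [forall p, _] => /=; case: [forall i, _] => /=; ring.
Qed.

End Polarization.

Lemma surj_ord_inj (l m : nat) (f : 'I_l -> 'I_m) :
  (l <= m)%N -> (forall a, exists s, f s = a) -> injective f.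
Proof.
move=> lm surj.
suff /image_injP h : #|image f 'I_l| == #|'I_l| by move=> x y; apply: h.
rewrite eqn_leq leq_image_card card_ord (leq_trans lm) // -{1}(card_ord m).
apply/subset_leq_card/subsetP => a _; have [s <-] := surj a.
exact: image_f.
Qed.

(** At most m cells covering all m indices of a direction cover each of them once. *)
Lemma matching_image (d m l : nat) (y : {ffun 'I_l -> cell d m}) :
  (l <= m)%N -> (forall j a, exists s, y s j = a) ->
  matching (fun=> setT) [set y s | s : 'I_l].
Proof.
move=> lm surj; apply/forallP => j; apply/forallP => a; rewrite inE.
have [s ys] := surj j a; apply/cards1P; exists (y s).
apply/setP => e; rewrite !inE; apply/andP/eqP => [[/imsetP[s' _ ->] /eqP ys']|->].
  congr (y _); apply: (surj_ord_inj lm (surj j)).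
  by rewrite ys ys'.
by rewrite imset_f // ys.
Qed.

(** * From the polynomial f to a form *)

Lemma prod_m2s (R : comNzRingType) (N : nat) (v : 'I_N -> R) (u : 'X_{1..N}) :
  \prod_(i <- m2s u) v i = \prod_i v i ^+ u i.
Proof.
rewrite /m2s big_flatten big_map big_enum /=; apply: eq_bigr => i _.
by rewrite big_nseq iter_mulr_1.
Qed.

Lemma m2s_perm_inj (N : nat) (u u' : 'X_{1..N}) :
  perm_eq (m2s u) (m2s u') -> u = u'.
Proof.
move=> /permP uu'; rewrite -(s2mK u) -(s2mK u').
by apply/mnmP => i; rewrite !mnmE uu'.
Qed.

(** Repeated variables of a monomial occupy separate positions, so that they can be polarized
    independently. *)
Definition word (d : nat) (n : 'I_d -> nat) (u : 'X_{1..#|tidx n|}) :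
    seq (tidx n) :=
  [seq enum_val i | i <- m2s u].

Lemma size_word d n u : size (@word d n u) = mdeg u.
Proof. by rewrite size_map size_m2s. Qed.

Section FormOfPoly.
Variables (K : fieldType) (d m : nat) (n : 'I_d -> nat).
Variables (f : {mpoly K[#|tidx n|]}) (iota : 'I_m -> tidx n).
Hypothesis d_gt0 : (0 < d)%N.
Hypothesis f_size : msize f = m.+1.

(** Coefficients of the polarized f. A monomial of degree below m has too few letters to cover all m
    indices, so it contributes 0. *)
Definition poly_form (E : {set cell d m}) : K :=
  \sum_(u <- msupp f) f@_u *
    #|[set y | @assembles d m n iota (word u) y
              && ([set y s | s in 'I_(size (word u))] == E)]|%:R.

Lemma size_word_le u : u \in msupp f -> (size (word u) <= m)%N.
Proof. by move=> /msize_mdeg_lt; rewrite size_word f_size. Qed.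

Lemma assembles_surj w y : @assembles d m n iota w y ->
  forall j a, exists s, y s j = a.
Proof.
by move=> /andP[/forallP h _] j a; have /existsP[s /eqP] := h (j, a); exists s.
Qed.

Lemma poly_form_matching E : poly_form E != 0 -> matching (fun=> setT) E.
Proof.
apply: contraR => nE; rewrite /poly_form big1_seq // => u /andP[_ uf].
rewrite (_ : [set y | _] = set0) ?cards0 ?mulr0 //.
apply/setP => y; rewrite !inE; apply/negP => /andP[/assembles_surj ys /eqP yE].
by move: nE; rewrite -yE matching_image // size_word_le.
Qed.

(** [polarization] is applied to each monomial of f and the assemblies are grouped by their image E.
    An assembly is injective, so its product over letters is the product over E. *)
Lemma form_val_poly_form (T : tensor K (fun _ : 'I_d => m)) :
  (\prod_(p : 'I_d * 'I_m) -1) * form_val poly_form T =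
  \sum_s alt_sign K s * f.@[fun k => polar_tensor iota T s (enum_val k)].
Proof.
under [RHS]eq_bigr do rewrite mevalE mulr_sumr.
rewrite exchange_big /= /form_val.
under [X in _ * X = _]eq_bigr do rewrite /poly_form mulr_suml.
rewrite [X in _ * X = _]exchange_big mulr_sumr /=.
rewrite big_seq_cond [RHS]big_seq_cond; apply: eq_bigr => u; rewrite andbT => uf.
under [X in _ * X = _]eq_bigr do rewrite -mulrA.
rewrite -mulr_sumr mulrCA.
transitivity (f@_u * \sum_s alt_sign K s * \prod_(x <- word u) polar_tensor iota T s x);
  last first.
  rewrite mulr_sumr; apply: eq_bigr => s _.
  by rewrite mulrCA big_map prod_m2s.
rewrite polarization; congr (_ * (_ * _)).
rewrite (partition_big (fun y : {ffun 'I_(size (word u)) -> cell d m} =>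
   [set y s | s in 'I_(size (word u))]) xpredT) //=; apply: eq_bigr => E _.
rewrite -sumr_const mulr_suml; apply: eq_big => [y|y]; first by rewrite inE.
rewrite inE mul1r => /andP[/assembles_surj ys /eqP <-].
rewrite big_imset //= => s s' _ _ yss'; have j := Ordinal d_gt0.
apply: (surj_ord_inj (size_word_le uf) (ys j)).
by rewrite yss'.
Qed.

Lemma poly_form_vanish (r : nat) (T : tensor K (fun _ : 'I_d => m)) :
  (0 < m)%N ->
  (forall T' : tensor K n, prk_le T' r -> f.@[fun k => T' (enum_val k)] = 0) ->
  prk_le T r -> form_val poly_form T = 0.
Proof.
move=> m_gt0 fT Tr; have /eqP := form_val_poly_form T.
rewrite [X in _ == X]big1 => [|s _]; last first.
  rewrite (fT (polar_tensor iota T s)) ?mulr0 //.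
  exact: (prk_le_linear_image
    (fun j x y => (iota y j == x)%:R * (s (j, y))%:R) m_gt0 Tr).
rewrite mulf_eq0 => /orP[|/eqP //].
by rewrite prodr_const expf_eq0 oppr_eq0 oner_eq0 andbF.
Qed.

End FormOfPoly.

(** * Nonvanishing of the polarized form *)

Definition diagonal (d m : nat) : {set cell d m} :=
  [set [ffun=> a] | a : 'I_m].

(** Here [iota] lists the letters of the leading monomial. An assembly with diagonal image only
    permutes these letters, so no other monomial contributes; the leading one has the identity
    assembly, and its positive count stays nonzero in characteristic 0. *)
Lemma poly_form_diagonal (K : fieldType) (d : nat) (n : 'I_d -> nat)
    (f : {mpoly K[#|tidx n|]}) :
  (0 < d)%N -> (forall k : nat, k%:R = 0 :> K -> k = 0%N) -> f != 0 ->
  poly_form f (tnth (in_tuple (word (mlead f))))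
    (diagonal d (size (word (mlead f)))) != 0.
Proof.
move=> d_gt0 K0 f0; set u0 := mlead f; set m := size _; set iota := tnth _.
have fm : msize f = m.+1 by rewrite /m size_word mlead_deg.
rewrite /poly_form (bigD1_seq u0) ?msupp_uniq ?mlead_supp //=.
rewrite big1_seq ?addr0 => [|u /andP[ne uf]]; last first.
  rewrite (_ : [set y | _] = set0) ?cards0 ?mulr0 //.
  apply/setP => y; rewrite !inE; apply/negP => /andP[ya /eqP yE].
  case/negP: ne; apply/eqP/m2s_perm_inj/(perm_map_inj enum_val_inj).
  rewrite -/(word u) -/(word u0).
  pose j0 := Ordinal d_gt0.
  have ydiag s j : y s j = y s j0.
    have : y s \in diagonal d m by rewrite -yE imset_f.
    by case/imsetP => a _ ->; rewrite !ffunE.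
  have ysurj := assembles_surj ya.
  have -> : word u = [seq iota i | i <- [seq y s j0 | s : 'I_(size (word u))]].
    rewrite -map_comp -[LHS](map_tnth_enum (in_tuple (word u))).
    apply: eq_map => s /=; apply/ffunP => j.
    by case/andP: ya => _ /forallP/(_ s)/forallP/(_ j)/eqP <-; rewrite ydiag.
  rewrite -[X in perm_eq _ X](map_tnth_enum (in_tuple (word u0))) perm_map //.
  apply: uniq_perm; rewrite ?enum_uniq //.
    rewrite map_inj_uniq ?enum_uniq //.
    exact: (surj_ord_inj (size_word_le fm uf) (ysurj j0)).
  move=> a; rewrite [RHS]mem_enum [RHS]inE; apply/imageP.
  by have [s <-] := ysurj j0 a; exists s.
rewrite mulf_neq0 ?mleadc_eq0 //; apply/eqP => /K0/eqP.
rewrite cards_eq0 => /set0Pn; apply.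
exists [ffun s => [ffun=> s]]; rewrite inE; apply/andP; split; last first.
  by apply/eqP/eq_imset => s; rewrite ffunE.
apply/andP; split.
  by apply/forallP => -[j a]; apply/existsP; exists a; rewrite !ffunE.
by apply/forallP => s; apply/forallP => j; rewrite !ffunE.
Qed.

(** * Pullbacks of T and the conclusion *)

Lemma subset_of_card (n m : nat) (A : {set 'I_n}) :
  (#|A| <= m <= n)%N -> exists2 X : {set 'I_n}, A \subset X & #|X| = m.
Proof.
have [k] := ubnP (m - #|A|); elim: k A => // k IH A; rewrite ltnS => Ak.
case/andP; rewrite leq_eqVlt => /orP[/eqP Am _|lt_Am mn]; first by exists A.
have /card_gt0P[x] : (0 < #|~: A|)%N.
  by have := cardsC A; rewrite card_ord; lia.
rewrite inE => xA; have [||X AX Xm] := IH (x |: A).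
- by rewrite cardsU1 xA; lia.
- by rewrite cardsU1 xA mn andbT.
by exists X => //; apply: subset_trans AX; apply: subsetUr.
Qed.

(** The image of [g j], which may have fewer than m elements, is enlarged to a set [X j] of size m;
    the pullback is then a relabelling of the subtensor on X. *)
Lemma prk_le_pullback (K : fieldType) (d m r : nat) (n : 'I_d -> nat)
    (T : tensor K n) (g : forall j, 'I_m -> 'I_(n j)) :
  (forall j, m <= n j)%N ->
  (forall X : forall j, {set 'I_(n j)},
     (forall j, #|X j| = m) -> prk_le (subtensor T X) r) ->
  prk_le (fun e : cell d m => T (relabel g e)) r.
Proof.
move=> mn hT.
have ex j : exists X : {set 'I_(n j)}, [set g j a | a : 'I_m] \subset X /\ #|X| = m.
  have [|X gX Xm] := @subset_of_card (n j) m [set g j a | a : 'I_m].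
    by rewrite mn andbT (leq_trans (leq_imset_card _ _)) ?card_ord.
  by exists X.
have [X hX] := fin_all_exists ex.
have gX j a : g j a \in X j.
  by have [/subsetP gX _] := hX j; apply/gX/imset_f.
have [S [A [B [pS [hA [hB hTe]]]]]] :=
  prk_le_relabel (fun j a => enum_rank_in (gX j a) (g j a))
    (hT X (fun j => proj2 (hX j))).
exists S, A, B; do 3![split=> //]; move=> e; rewrite -hTe; congr T.
by apply/ffunP => j; rewrite !ffunE enum_rankK_in ?gX.
Qed.

Theorem theorem2 (d r m : nat) (hd : (2 <= d)%N) (hr : (1 <= r)%N)
  (hm : (1 <= m)%N)
  (hpoly : exists (n0 : 'I_d -> nat) (f : {mpoly Cplx[#|tidx n0|]}),
      (forall j, 0 < n0 j)%N /\ f != 0 /\ msize f = m.+1 /\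
      (forall T : tensor Cplx n0, prk_le T r -> eval_tensor f T = 0)) :
  (forall (K : fieldType) (n : 'I_d -> nat), (forall j, m <= n j)%N ->
     forall T : tensor K n,
       (forall X : forall j : 'I_d, {set 'I_(n j)},
          (forall j, #|X j| = m) -> prk_le (subtensor T X) r) ->
       prk_le T (prk_bound d m))
  /\ (3 <= d -> prk_bound d m <= m ^ d)%N.
Proof.
split; last exact: prk_bound_le_expn.
move=> K n mn T hT.
have natC k : k%:R = 0 :> Cplx -> k = 0%N.
  by move/eqP; rewrite Num.Theory.pnatr_eq0 => /eqP.
have intC (z : int) : z%:~R = 0 :> Cplx -> z = 0.
  by move/eqP; rewrite intr_eq0 => /eqP.
have [n0 [f [n0_gt0 [f0 [f_size fv]]]]] := hpoly.
have size_m : size (word (mlead f)) = m.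
  by apply: succn_inj; rewrite -f_size size_word mlead_deg.
(* Replacing m by the length of the leading word lets [iota] enumerate that word with domain
   ['I_m]. *)
move: mn hT f_size hm hpoly; case: m / size_m => mn hT f_size hm _.
have d_gt0 := ltnW hd.
have [c [[E cE] [cI cv]]] := form_transfer K intC
  (poly_form_matching f_size)
  (poly_form_diagonal d_gt0 natC f0)
  (fun T => poly_form_vanish _ d_gt0 f_size hm fv).
apply: prk_le_trans (prk_le_of_form hd cI cE _ _) => //.
- exact: leq_addl.
- by move=> g; apply: cv; apply: prk_le_pullback.
by move=> j; apply: leq_trans (mn j).
Qed.
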